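(* Let $n\in\mathbb{N}$, and let $S_{2n}=\{y\in[0,\tfrac23]:|L(y)|=2n\}$. If there are distinct integers $k$ and $l$ such that $2n=2^k-2^l$, then $\lambda(S_{2n})>0$, where $\lambda$ denotes Lebesgue measure.
   Context: Let $\phi(x)=\operatorname{dist}(x,\mathbb{Z})$; the Takagi function is $T(x)=\sum_{n=0}^\infty 2^{-n}\phi(2^nx)$, and $L(y)=\{x\in[0,1]:T(x)=y\}$. $|\cdot|$ denotes cardinality. $\mathbb{N}=\{1,2,3,\dots\}$. *)

(* Defs.v *)
From HB Require Import structures.
From mathcomp Require Import all_boot all_order all_algebra.
From mathcomp Require Import all_classical all_reals all_analysis.
Set Implicit Arguments.
Unset Strict Implicit.
Unset Printing Implicit Defensive.
Import Order.TTheory GRing.Theory Num.Theory numFieldNormedType.Exports.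
Local Open Scope classical_set_scope.
Local Open Scope ring_scope.

Definition distZ (R : realType) (x : R) : R :=
  inf [set `|x - m%:~R| | m in [set: int]].

(* [limn] is a total operator; the series converges since distZ is bounded. *)
Definition takagi (R : realType) (x : R) : R :=
  limn (series (fun n : nat => 2 ^- n * distZ (2 ^+ n * x))).

Definition level_set (R : realType) (y : R) : set R :=
  [set x | x \in `[0, 1] /\ takagi x = y].

(* This set is Borel because takagi is continuous, so the library's total
   (outer) lebesgue_measure agrees with its Lebesgue measure. *)
Definition level_card_set (R : realType) (m : nat) : set R :=
  [set y | y \in `[0, 2 / 3] /\ (level_set y #= `I_m)%card].

(* Main.v *)
Require Import Defs.
From HB Require Import structures.
From mathcomp Require Import all_boot all_order all_algebra.
From mathcomp Require Import finmap.
From mathcomp Require Import all_classical all_reals all_analysis.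
From mathcomp Require Import measurable_realfun.
From mathcomp Require Import ring lra zify.
Import Order.TTheory GRing.Theory Num.Theory numFieldNormedType.Exports.
Local Open Scope classical_set_scope.
Local Open Scope ring_scope.

(* Write f_a(t) = T(t) + a t on [0,1] and N_a(y) for the number of solutions of
   f_a(t) = y, so that N_0(y) = |L(y)|. Halving [0,1] gives
     N_a(y) = N_(a+1)(2y) + N_(a-1)(2y - a - 1)   unless 2y = a + 1,
   and for integers a >= 1 both terms are nonzero only if 2y - a - 1 lies in
   [0, 2^-a / 3]. Following y through these branchings is a walk on pairs
   (a, y); the set of y in [0,a] whose walk ever meets such an overlap has
   measure at most (2/3)(1 - 2^-a), and N_a(y) = 1 off this set.
   In an overlap, where 2y = a + 1 + w / 2^(a+1) with 1/6 < w <= 2/3, reflection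
   turns the first term into N_0(w), while the second one is
   N_(a-1)(w / 2^(a+1)) = N_b(2^i w) with b = 2a + i; for large i and a ~ 2^i it
   equals 1 except on a set of w of measure at most (2/3) 2^-i. Hence if N_0 = c
   on a set of positive measure inside (1/6, 2/3], then N_a = c + 1 on a set of
   positive measure, and going back to level 0 along a walk without overlaps
   yields N_0 = 2(c + 1). Starting from N_1 = 1, this gives every value
   2(2^m - 1). Finally N_0(1/2 + w/4) = 2 N_0(w) for w in (1/6, 2/3]. *)

Lemma exists_expN2_lt (R : realType) (e : R) : 0 < e -> exists k, 2 ^- k < e.
Proof.
move=> e0.
have : (fun k => 2 ^- k : R^o) @ \oo --> 0.
  under eq_fun do rewrite -exprVn; apply: cvg_expr.
  by rewrite ger0_norm ?invf_lt1 ?invr_ge0 // ltr1n.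
move=> /cvgrPdist_lt /(_ e e0)[k _ /(_ k (leqnn k))].
by rewrite sub0r normrN ger0_norm ?invr_ge0 ?exprn_ge0 //; exists k.
Qed.

(** * The Takagi function *)

Section Takagi.
Context {R : realType}.
Implicit Types x y t : R.

Lemma distZ_le x (m : int) : distZ x <= `|x - m%:~R|.
Proof.
apply: ge_inf; last by exists m.
by exists 0 => _ [k _ <-].
Qed.

Lemma distZ_ge x y : (forall m : int, y <= `|x - m%:~R|) -> y <= distZ x.
Proof.
move=> h; apply: lb_le_inf; first by exists `|x - 0%:~R|, 0.
by move=> _ [m _ <-].
Qed.

Lemma distZ_ge0 x : 0 <= distZ x.
Proof. exact: distZ_ge. Qed.

Lemma distZ_le_half x : distZ x <= 1 / 2.
Proof.
have := distZ_le x (Num.floor x); have := distZ_le x (Num.floor x + 1).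
have := Num.Theory.floor_le x; have := Num.Theory.floorD1_gt x.
rewrite intrD => h1 h2; rewrite ler0_norm; last lra.
rewrite ger0_norm; [by move=> *; lra|lra].
Qed.

Lemma distZ_lipschitz x y : distZ x <= `|x - y| + distZ y.
Proof.
rewrite -lerBlDl; apply: distZ_ge => m; rewrite lerBlDl.
apply: le_trans (distZ_le x m) _.
exact: ler_distD.
Qed.

Lemma distZ_reflect (m : int) x : distZ (m%:~R - x) = distZ x.
Proof.
have le (z : R) : distZ (m%:~R - z) <= distZ z.
  apply: distZ_ge => k; apply: le_trans (distZ_le _ (m - k)) _.
  by rewrite intrB (_ : _ - _ - _ = k%:~R - z) 1?distrC //; ring.
apply/eqP; rewrite eq_le le /=.
by have := le (m%:~R - x); rewrite opprB addrCA subrr addr0.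
Qed.

Lemma distZ_id x : 0 <= x <= 1 / 2 -> distZ x = x.
Proof.
move=> /andP[x0 x1]; apply/eqP; rewrite eq_le; apply/andP; split.
  by have := distZ_le x 0; rewrite subr0 ger0_norm.
apply: distZ_ge => m; have [m0|m0] := leP m 0.
  have : m%:~R <= 0 :> R by rewrite lerz0.
  by move=> ?; rewrite ger0_norm; lra.
have : 1 <= m%:~R :> R by rewrite ler1z.
by move=> ?; rewrite ler0_norm; lra.
Qed.

Definition takagi_term x n : R := 2 ^- n * distZ (2 ^+ n * x).

Lemma takagi_term_ge0 x n : 0 <= takagi_term x n.
Proof. by rewrite mulr_ge0 ?distZ_ge0 // invr_ge0 exprn_ge0. Qed.

Lemma takagi_sum_le1 x n : series (takagi_term x) n <= 1.
Proof.
(* Each term is at most [2 ^- i / 2]; the sharper geometric bound is the one that survives the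
   induction. *)
suff : series (takagi_term x) n <= 1 - 2 ^- n.
  by move=> /le_trans; apply; rewrite gerBl invr_ge0 exprn_ge0.
rewrite /series /=; elim: n => [|n IH]; first by rewrite big_geq // expr0 invr1 subrr.
rewrite big_nat_recr //=.
have : takagi_term x n <= 2 ^- n * (1 / 2).
  by rewrite ler_wpM2l ?distZ_le_half // invr_ge0 exprn_ge0.
by rewrite exprS invfM; lra.
Qed.

Lemma takagi_cvg x : series (takagi_term x) @ \oo --> takagi x.
Proof.
suff : cvgn (series (takagi_term x)) by [].
apply: nondecreasing_is_cvgn; last first.
  by exists 1 => _ [n _ <-]; exact: takagi_sum_le1.
by apply: nondecreasing_series => n _ _; exact: takagi_term_ge0.
Qed.

Lemma takagi_ge0 x : 0 <= takagi x.
Proof.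
apply: limr_ge; first exact/cvgP/takagi_cvg.
by apply: nearW => n; rewrite /series /= sumr_ge0 // => i _; exact: takagi_term_ge0.
Qed.

Lemma takagi_le1 x : takagi x <= 1.
Proof.
apply: limr_le; first exact/cvgP/takagi_cvg.
by apply: nearW => n; exact: takagi_sum_le1.
Qed.

Lemma takagi_rec x : takagi x = distZ x + takagi (2 * x) / 2.
Proof.
have := takagi_cvg x; rewrite -cvg_shiftS => cx.
apply: (cvg_unique _ cx) => //=.
rewrite (_ : (fun n => _) = (fun n => distZ x + series (takagi_term (2 * x)) n / 2)).
  apply: cvgD; first exact: cvg_cst.
  by apply: cvgMl; exact: takagi_cvg.
apply/funext => n; rewrite /series /= big_nat_recl // {1}/takagi_term expr0 invr1 !mul1r.
congr (_ + _); rewrite mulr_suml; apply: eq_bigr => i _.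
by rewrite /takagi_term exprSr mulrA invfM mulrAC.
Qed.

Lemma takagi_reflect x : takagi (1 - x) = takagi x.
Proof.
rewrite /takagi; congr (limn (series _)); apply/funext => n.
rewrite mulrBr mulr1; congr (_ * _).
by rewrite -[2 ^+ n]/(2%:~R ^+ n) -rmorphXn distZ_reflect.
Qed.

Lemma takagi_half t : 0 <= t <= 1 -> takagi (t / 2) = (t + takagi t) / 2.
Proof.
move=> t01; rewrite takagi_rec distZ_id; last lra.
by rewrite (_ : 2 * (t / 2) = t); lra.
Qed.

Lemma takagi_half_right t :
  0 <= t <= 1 -> takagi ((1 + t) / 2) = (1 - t + takagi t) / 2.
Proof.
move=> t01; rewrite -takagi_reflect (_ : 1 - _ = (1 - t) / 2); last by field.
by rewrite takagi_half ?takagi_reflect //; lra.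
Qed.

Lemma takagi0 : takagi 0 = 0 :> R.
Proof. by have := @takagi_half 0; rewrite mul0r; lra. Qed.

Lemma takagi1 : takagi 1 = 0 :> R.
Proof. by rewrite -takagi_reflect subrr takagi0. Qed.

(** Unfolding [takagi_rec] [n] times costs [|x - y|] each time, since doubling the argument is
    offset by halving the value; the tail is controlled by [0 <= takagi <= 1]. *)
Lemma takagi_modulus n x y : `|takagi x - takagi y| <= n%:R * `|x - y| + 2 ^- n.
Proof.
elim: n x y => [|n IH] x y.
  rewrite mul0r add0r expr0 invr1 ler_norml.
  have := takagi_ge0 x; have := takagi_ge0 y; have := takagi_le1 x; have := takagi_le1 y.
  by move=> *; lra.
have := IH (2 * x) (2 * y); rewrite -mulrBr normrM (ger0_norm (ltW (ltr0Sn R 1))).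
rewrite [takagi x]takagi_rec [takagi y]takagi_rec => h.
have := distZ_lipschitz x y; have := distZ_lipschitz y x; rewrite (distrC y).
rewrite exprS invfM (_ : n.+1%:R = n%:R + 1); last by rewrite natr1.
set p := 2 ^- n in h *; set d := `|x - y| in h *.
move: h; rewrite !ler_norml => /andP[h1 h2] h3 h4.
lra.
Qed.

Lemma takagi_continuous : continuous (@takagi R).
Proof.
move=> x; apply/(@cvgrPdist_le _ R^o) => e e0.
have [n hn] := exists_expN2_lt _ (e / 2) ltac:(lra).
near=> y; apply: le_trans (takagi_modulus n x y) _.
have : `|x - y| <= e / (2 * n.+1%:R).
  near: y; apply: (@cvgr_dist_le _ R^o) => //; rewrite divr_gt0 // mulr_gt0 //.
rewrite ler_pdivlMr ?mulr_gt0 // -natr1; have : 0 <= `|x - y| by [].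
by nra.
Unshelve. all: end_near. Qed.
End Takagi.

(** * Solutions of T(t) + a t = y *)

Section Tilt.
Context {R : realType}.
Implicit Types a t w x y z : R.

(** Two unfoldings and [2 * distZ z + distZ (2 * z) <= 1] give [s <= 1 / 2 + s / 4] for the supremum
    [s]. *)
Lemma takagi_le x : takagi x <= 2 / 3.
Proof.
have step z : takagi z <= 1 / 2 + takagi (4 * z) / 4.
  rewrite takagi_rec (takagi_rec (2 * z)) mulrA (_ : 2 * 2 = 4); last by rewrite -natrM.
  suff : 2 * distZ z + distZ (2 * z) <= 1 by move=> *; lra.
  have k1 := Num.Theory.floor_le z; have k2 := Num.Theory.floorD1_gt z.
  set k := Num.floor z in k1 k2; rewrite intrD in k2.
  have h1 := distZ_le z k; have h2 := distZ_le z (k + 1).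
  have h3 := distZ_le (2 * z) (2 * k + 1).
  rewrite ger0_norm in h1; last lra.
  rewrite intrD ler0_norm in h2; last lra.
  rewrite intrD intrM in h3.
  have [h|h] := lerP (z - k%:~R) (1 / 2).
    by rewrite ler0_norm in h3; lra.
  by rewrite ger0_norm in h3; lra.
pose s := sup (range (@takagi R)).
have ub z : takagi z <= s.
  apply: ub_le_sup; last by exists z.
  by exists 1 => _ [u _ <-]; exact: takagi_le1.
suff : s <= 1 / 2 + s / 4 by move=> ?; have := ub x; lra.
apply: ge_sup; first by exists (takagi 0), 0.
by move=> _ [z _ <-]; have := step z; have := ub (4 * z); lra.
Qed.

Definition tilt a t := takagi t + a * t.

Definition sols a y : set R := [set t | 0 <= t <= 1 /\ tilt a t = y].

Lemma tilt_half a t : 0 <= t <= 1 -> tilt a (t / 2) = tilt (a + 1) t / 2.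
Proof. by move=> h; rewrite /tilt takagi_half //; field. Qed.

Lemma tilt_half_right a t :
  0 <= t <= 1 -> tilt a ((1 + t) / 2) = (a + 1 + tilt (a - 1) t) / 2.
Proof. by move=> h; rewrite /tilt takagi_half_right //; field. Qed.

Lemma tilt_reflect a t : tilt a (1 - t) = a + tilt (- a) t.
Proof. by rewrite /tilt takagi_reflect; ring. Qed.

Lemma tilt_ge0 a t : 0 <= a -> 0 <= t -> 0 <= tilt a t.
Proof. by move=> a0 t0; rewrite addr_ge0 ?takagi_ge0 ?mulr_ge0. Qed.

(** The excess over [n] halves with each level along the right half; on the left half [takagi_le]
    and [t <= 1 / 2] suffice. This excess fixes the width of the overlaps. *)
Lemma tilt_le (n : nat) t : 0 <= t <= 1 -> tilt n%:R t <= n%:R + 2 / 3 * 2 ^- n.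
Proof.
elim: n t => [|n IH] t t01.
  by rewrite /tilt expr0 invr1 mul0r addr0 add0r mulr1 takagi_le.
have p0 : 0 < 2 ^- n :> R by rewrite invr_gt0 exprn_gt0.
have nS : n.+1%:R = n%:R + 1 :> R by rewrite natr1.
rewrite exprS invfM; have [th|th] := lerP t (1 / 2).
  have := takagi_le t; rewrite /tilt; case: n nS p0 {IH} => [|n] nS p0 h.
    by rewrite expr0 invr1; lra.
  have n0 : 0 <= n%:R :> R by [].
  by rewrite nS -natr1; nra.
rewrite (_ : t = (1 + (2 * t - 1)) / 2) ?tilt_half_right; [|lra|by field].
have := IH (2 * t - 1); rewrite nS addrK => /(_ _); lra.
Qed.

Lemma tilt_neg_le (n : nat) t : 0 <= t <= 1 -> tilt (- n%:R) t <= 2 / 3 * 2 ^- n.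
Proof.
move=> h; rewrite -(lerD2l n%:R) -tilt_reflect.
by apply: tilt_le; lra.
Qed.

(** * Counting solutions by halving the interval *)

Lemma sols_split a y : sols a y =
  (fun t => t / 2) @` sols (a + 1) (2 * y) `|`
  (fun t => (1 + t) / 2) @` sols (a - 1) (2 * y - (a + 1)).
Proof.
apply/seteqP; split => [t [t01 ty]|_ [|] [t [t01 ty] <-]].
- have [th|th] := lerP t (1 / 2); [left; exists (2 * t)|right; exists (2 * t - 1)].
  + split; first lra.
    have := @tilt_half a (2 * t); rewrite (_ : 2 * t / 2 = t); last by field.
    by rewrite ty => ->; [field|lra].
  + by field.
  + split; first lra.
    have := @tilt_half_right a (2 * t - 1).
    rewrite (_ : (1 + _) / 2 = t); last by field.
    by rewrite ty => ->; [field|lra].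
  + by field.
- by split; [lra|rewrite tilt_half // ty; field].
- by split; [lra|rewrite tilt_half_right // ty; field].
Qed.

Lemma inj_half : injective (fun t : R => t / 2).
Proof. by move=> s t; lra. Qed.

Lemma inj_half_right : injective (fun t : R => (1 + t) / 2).
Proof. by move=> s t; lra. Qed.

Lemma card_image_inj (f : R -> R) (A : set R) : injective f -> (f @` A #= A)%card.
Proof. by move=> fi; apply: inj_card_eq => s t _ _; exact: fi. Qed.

Lemma card_setU_II (A B : set R) m n : A `&` B = set0 ->
  (A #= `I_m -> B #= `I_n -> A `|` B #= `I_(m + n))%card.
Proof.
move=> AB0 hA hB.
have fA : finite_set A by apply/finite_setP; exists m.
have fB : finite_set B by apply/finite_setP; exists n.
rewrite -[A]fset_setK // -[B]fset_setK // -set_fsetU; apply/card_eq_fsetP.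
rewrite cardfsU (card_fset_set hA) (card_fset_set hB).
by rewrite -fset_setI // AB0 fset_set0 cardfs0 subn0.
Qed.

Lemma sols_lower a y : 1 <= a -> 2 * y < a + 1 ->
  sols a y = (fun t => t / 2) @` sols (a + 1) (2 * y).
Proof.
move=> a1 ya; rewrite sols_split (_ : sols (a - 1) _ = set0) ?image_set0 ?setU0 //.
by apply/seteqP; split => // t [t01 ty]; have := @tilt_ge0 (a - 1) t; lra.
Qed.

(** By [tilt_le] at level [n.+1], the left half cannot reach such a large value. *)
Lemma sols_upper (n : nat) y : n%:R + 1 + 1 / 3 * 2 ^- n < 2 * y ->
  sols n%:R y = (fun t => (1 + t) / 2) @` sols (n%:R - 1) (2 * y - (n%:R + 1)).
Proof.
move=> yn; rewrite sols_split (_ : sols (n%:R + 1) _ = set0) ?image_set0 ?set0U //.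
apply/seteqP; split => // t [t01 ty]; have := @tilt_le n.+1 t t01.
by rewrite -natr1 ty exprS invfM; lra.
Qed.

Lemma card_sols_lower a y : 1 <= a -> 2 * y < a + 1 ->
  (sols a y #= sols (a + 1) (2 * y))%card.
Proof. by move=> a1 ya; rewrite sols_lower //; exact/card_image_inj/inj_half. Qed.

Lemma card_sols_upper (n : nat) y : n%:R + 1 + 1 / 3 * 2 ^- n < 2 * y ->
  (sols n%:R y #= sols (n%:R - 1) (2 * y - (n%:R + 1)))%card.
Proof. by move=> yn; rewrite sols_upper //; exact/card_image_inj/inj_half_right. Qed.

Lemma card_sols_reflect a z : (sols a (a + z) #= sols (- a) z)%card.
Proof.
rewrite (_ : sols a _ = (fun t => 1 - t) @` sols (- a) z).
  by apply: card_image_inj => s t; lra.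
apply/seteqP; split => [t [t01 ty]|_ [t [t01 ty] <-]].
  exists (1 - t); last by ring.
  split; first lra.
  by rewrite tilt_reflect opprK ty addKr.
by split; [lra|rewrite tilt_reflect ty].
Qed.

(** Halving keeps only the left piece: the right one would need the value [n + w / 2 ^ n] at slope
    [- (n + 2)], where [tilt_neg_le] allows at most [2 ^- n / 6]. Hence the threshold [1 / 6]. *)
Lemma card_sols_neg (n : nat) w : 1 / 6 < w ->
  (sols (- n%:R) (w / 2 ^+ n) #= sols 0 w)%card.
Proof.
move=> w6; elim: n => [|n IH]; first by rewrite oppr0 expr0 divr1 card_eqxx.
have p0 : 0 < 2 ^- n :> R by rewrite invr_gt0 exprn_gt0.
have nS k : k.+1%:R = k%:R + 1 :> R by rewrite natr1.
apply: card_eq_trans IH; rewrite sols_split (nS n) exprS invfM.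
rewrite [X in _ `|` X](_ : _ = set0).
  rewrite setU0 (_ : - _ + 1 = - n%:R); last by ring.
  rewrite (_ : 2 * _ = w / 2 ^+ n); last by field; rewrite expf_neq0.
  exact/card_image_inj/inj_half.
rewrite (_ : sols _ _ = set0) ?image_set0 //.
apply/seteqP; split => // t [t01]; have := @tilt_neg_le n.+2 t t01.
rewrite (nS n.+1) (nS n) !exprS !invfM (opprD (_ + 1)).
move=> h e; rewrite e in h; have : 0 <= n%:R :> R by [].
have : 0 < (w - 1 / 6) * 2 ^- n by rewrite mulr_gt0 // subr_gt0.
by move=> *; lra.
Qed.

Lemma card_sols_add a y m n : 2 * y != a + 1 ->
  (sols (a + 1) (2 * y) #= `I_m -> sols (a - 1) (2 * y - (a + 1)) #= `I_n ->
   sols a y #= `I_(m + n))%card.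
Proof.
move=> ne hm hn; rewrite sols_split; apply: card_setU_II.
- apply/seteqP; split => // _ [[t [t01 ty] <-] [s [s01 sy] e]].
  (* The halves meet only at [1 / 2], that is [t = 1], which is a solution only for the excluded
     [y]. *)
  have t1 : t = 1 by lra.
  by move: ne; rewrite -ty t1 /tilt takagi1 mulr1 add0r eqxx.
- by rewrite (card_eql (card_image_inj _ _ inj_half)).
- by rewrite (card_eql (card_image_inj _ _ inj_half_right)).
Qed.

(** Bounding the last value is enough: if it lies below its level, halving shows the same for every
    earlier one. *)
Lemma card_sols_climb (n i : nat) z : (0 < n)%N -> 2 ^+ i * z < (n + i)%:R ->
  (sols n%:R z #= sols (n + i)%:R (2 ^+ i * z))%card.
Proof.
move=> n0; elim: i => [|i IH] h; first by rewrite expr0 mul1r addn0 card_eqxx.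
have n1 : 1 <= (n + i)%:R :> R by rewrite ler1n addn_gt0 n0.
have nS : (n + i).+1%:R = (n + i)%:R + 1 :> R by rewrite natr1.
rewrite addnS nS exprS -mulrA in h *.
apply: card_eq_trans (IH _) _; first by lra.
exact: card_sols_lower.
Qed.

Lemma sols0E y : sols 0 y = level_set y.
Proof.
by apply/seteqP; split => t [t01 ty]; split;
  rewrite ?in_itv //= -?ty /tilt ?mul0r ?addr0 //; rewrite in_itv in t01.
Qed.

(** At slope [0] the two pieces have slopes [1] and [-1] and are mirror images of each other. *)
Lemma card_level_double y m : 2 * y != 1 ->
  (sols 1 (2 * y) #= `I_m -> level_set y #= `I_(2 * m))%card.
Proof.
move=> y1 hm; rewrite -sols0E mul2n -addnn; apply: card_sols_add; rewrite ?add0r //.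
rewrite -(card_eql (card_sols_reflect 1 _)).
by rewrite addrCA subrr addr0.
Qed.

Lemma card_level_hump w m : 1 / 6 < w ->
  (level_set w #= `I_m -> level_set (1 / 2 + w / 4) #= `I_(2 * m))%card.
Proof.
move=> w6 hm; apply: card_level_double; first by apply/negP => /eqP; lra.
rewrite (_ : 2 * _ = 1 + w / 2); last by field.
rewrite (card_eql (card_sols_reflect 1 _)) (card_eql (card_sols_neg 1 _ w6)).
by rewrite sols0E.
Qed.
End Tilt.

(** * Overlapping walks *)

Section Measure.
Context {R : realType}.
Local Notation mu := (@lebesgue_measure R).
Implicit Types (A B : set R).

(** * Lebesgue measure under affine maps *)

Lemma measurable_affine (a b : R) A : measurable A ->
  measurable ((fun x => a * x + b) @^-1` A).
Proof.
move=> mA; rewrite -[X in measurable X]setTI.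
have : measurable_fun [set: R] (fun x : R => a * x + b).
  by apply: measurable_funD => //; exact: measurable_funM.
exact.
Qed.

(** The pushforward scaled by [a] agrees with [mu] on half-open intervals, hence everywhere by
    uniqueness. *)
Lemma lebesgue_measure_affine (a b : R) A : 0 < a -> measurable A ->
  mu ((fun x => a * x + b) @^-1` A) = ((a^-1)%:E * mu A)%E.
Proof.
move=> a0 mA; pose f (x : measurableTypeR R) : measurableTypeR R := a * x + b.
have mf : measurable_fun [set: measurableTypeR R] f.
  by apply: measurable_funD => //; exact: measurable_funM.
have a0' := ltW a0.
pose pf : {measure set (measurableTypeR R) -> \bar R} := pushforward mu f.
pose nu : {measure set (measurableTypeR R) -> \bar R} := mscale (NngNum a0') (pf mf).
suff -> : mu A = nu A by rewrite /nu /mscale /= muleA -EFinM mulVf ?gt_eqF // mul1e.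
apply: (@lebesgue_measure_unique R nu) => // _ [[c d] _ <-].
rewrite /nu /= /mscale /= /pushforward.
have -> : f @^-1` `]c, d]%classic = `](c - b) / a, (d - b) / a]%classic.
  apply/seteqP; split => x /=; rewrite !in_itv /= /f ltr_pdivrMr // ler_pdivlMr //;
    by rewrite ltrBlDr lerBrDr (mulrC x).
rewrite !lebesgue_measure_itv /= !lte_fin ltr_pM2r ?invr_gt0 // ltrD2r.
case: ifP => _; last by rewrite mule0.
by rewrite -!EFinD -EFinM; congr _%:E; field; rewrite gt_eqF.
Qed.

Lemma lebesgue_measure_setD_gt0 A B : measurable A -> measurable B ->
  (mu B < mu A -> 0 < mu (A `\` B))%E.
Proof.
move=> mA mB BA; rewrite lt0e measure_ge0 andbT; apply: contraL BA => /eqP AB0.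
rewrite -leNgt -[leRHS]adde0 -AB0; apply: le_trans (measureU2 _ _ _) => //; last first.
  exact: measurableD.
apply: le_measure; rewrite ?inE //.
- by apply: measurableU => //; exact: measurableD.
- by move=> x Ax; have [Bx|nBx] := pselect (B x); [left|right].
Qed.

Lemma lebesgue_measureU2 A B : measurable A -> measurable B ->
  (mu (A `|` B) <= mu A + mu B)%E.
Proof. exact: (@measureU2 _ _ _ mu). Qed.

Lemma lebesgue_measure_segment (c e : R) : 0 < e -> mu `[c, c + e]%classic = e%:E.
Proof.
move=> e0; rewrite lebesgue_measure_itv /= lte_fin ltrDl e0.
by rewrite -EFinD addrAC subrr add0r.
Qed.

(* Asking for a measurable subset avoids proving that level sets of the solution
   count are measurable. *)
Definition charged (P : set R) :=
  exists A, [/\ measurable A, A `<=` P & (0 < mu A)%E].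

Lemma charged_affine (a b : R) (P Q : set R) : 0 < a ->
  (forall x, P (a * x + b) -> Q x) -> charged P -> charged Q.
Proof.
move=> a0 PQ [A [mA AP A0]]; exists ((fun x => a * x + b) @^-1` A); split.
- exact: measurable_affine.
- by move=> x /AP /PQ.
- by rewrite lebesgue_measure_affine // mule_gt0 // lte_fin invr_gt0.
Qed.

Lemma charged_outer_gt0 (P : set R) : charged P -> (0 < mu P)%E.
Proof.
by move=> [A [mA AP A0]]; apply: lt_le_trans A0 _; exact: le_outer_measure.
Qed.

(* [overlap k n] contains the [y] whose walk from level [n] meets an overlap
   within [k] steps; it need not be contained in [[0, n]]. *)
Fixpoint overlap (k n : nat) : set R :=
  if k isn't k'.+1 then set0 else if n isn't n'.+1 then set0 else
  (fun y => 2 * y + 0) @^-1` overlap k' n.+1 `|`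
  `[(n.+1)%:R / 2, (n.+1)%:R / 2 + 1 / 6 * 2 ^- n] `|`
  (fun y => 2 * y - n.+1%:R) @^-1` overlap k' n'.

Lemma measurable_overlap k n : measurable (overlap k n).
Proof.
elim: k n => [|k IH] [|n] //=.
by apply: measurableU; [apply: measurableU => //|]; exact: measurable_affine.
Qed.

(* The bound [h n = 2 / 3 * (1 - 2 ^- n)] is the solution of
   [h n.+1 = (h n.+2 + h n) / 2 + 1 / 6 * 2 ^- n.+1] with [h 0 = 0]. *)
Lemma measure_overlap_le k n :
  (mu (overlap k n) <= (2 / 3 * (1 - 2 ^- n))%:E)%E.
Proof.
elim: k n => [|k IH] [|n]; rewrite ?measure0 ?lee_fin ?expr0 ?invr1 ?subrr ?mulr0 //.
  rewrite mulr_ge0 // subr_ge0 invf_le1 ?exprn_gt0 // exprn_ege1 //; lra.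
have m1 : measurable ((fun y : R => 2 * y + 0) @^-1` overlap k n.+2).
  by apply: measurable_affine; exact: measurable_overlap.
have m2 : measurable ((fun y : R => 2 * y - n.+2%:R) @^-1` overlap k n).
  by apply: measurable_affine; exact: measurable_overlap.
rewrite [overlap _ _]/=. have m3 : measurable (`[n.+2%:R / 2, n.+2%:R / 2 + 1 / 6 / 2 ^+ n.+1]%classic : set R) by [].
apply: le_trans (lebesgue_measureU2 _ _ (measurableU _ _ m1 m3) m2) _.
apply: le_trans (leeD (lebesgue_measureU2 _ _ m1 m3) (lexx _)) _.
rewrite !lebesgue_measure_affine //; try exact: measurable_overlap.
have p0 : 0 < 2 ^- n :> R by rewrite invr_gt0 exprn_gt0.
have -> : (2 / 3 * (1 - 2 ^- n.+1) = 2^-1 * (2 / 3 * (1 - 2 ^- n.+2)) +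
   1 / 6 * 2 ^- n.+1 + 2^-1 * (2 / 3 * (1 - 2 ^- n)) :> R)%R.
  by rewrite !exprS !invfM; set p := 2 ^- n; field.
rewrite lebesgue_measure_segment; last by rewrite mulr_gt0 ?invr_gt0 ?exprn_gt0 //; lra.
rewrite EFinD EFinD; apply: leeD; last first.
  by rewrite EFinM; apply: lee_pmul => //; rewrite lee_fin; lra.
apply: leeD => //.
rewrite EFinM; apply: lee_pmul => //; rewrite lee_fin; lra.
Qed.

Lemma overlap_homo n : nondecreasing_seq (overlap^~ n).
Proof.
apply/nondecreasing_seqP => k; apply/subsetPset.
elim: k n => [|k IH] [|n] //=.
by move=> y [[/IH|]|/IH] h; [left;left|left;right|right].
Qed.

Definition overlaps n : set R := \bigcup_k overlap k n.

Lemma measurable_overlaps n : measurable (overlaps n).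
Proof. by apply: bigcupT_measurable => k; exact: measurable_overlap. Qed.

(** Continuity from below along the increasing sets [overlap k n], whose bound is uniform in [k]. *)
Lemma measure_overlaps_le n : (mu (overlaps n) <= (2 / 3 * (1 - 2 ^- n))%:E)%E.
Proof.
have h := nondecreasing_cvg_mu (mu := mu) (fun k => measurable_overlap k n)
  (measurable_overlaps n) (@overlap_homo n).
rewrite -(cvg_lim _ h) //; apply: lime_le; first by apply/cvg_ex; eexists; exact: h.
by apply: nearW => k; exact: measure_overlap_le.
Qed.

Lemma overlapsSP n y : ~ overlaps n.+1 y ->
  [/\ ~ overlaps n.+2 (2 * y), ~ overlaps n (2 * y - n.+2%:R) &
      2 * y < n.+2%:R \/ n.+2%:R + 1 / 3 * 2 ^- n.+1 < 2 * y].
Proof.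
move=> nb; split.
- by move=> [k _ h]; apply: nb; exists k.+1 => //; left; left; rewrite /= addr0.
- by move=> [k _ h]; apply: nb; exists k.+1 => //; right.
- have [h|h1] := ltP (2 * y) n.+2%:R; first by left.
  right; rewrite ltNge; apply/negP => h2; apply: nb; exists 1%N => //; left; right.
  by rewrite /= in_itv /=; lra.
Qed.

(** Off the overlaps only one half of the interval can hold solutions, so any two of them share
    their first [k] binary choices. *)
Lemma sols_close k n y s t : (0 < n)%N -> 0 <= y <= n%:R -> ~ overlaps n y ->
  sols n%:R y s -> sols n%:R y t -> `|s - t| <= 2 ^- k.
Proof.
elim: k n y s t => [|k IH] [|n] y s t // _ yn.
  by move=> _ [s01 _] [t01 _]; rewrite expr0 invr1 ler_norml; lra.
move=> /overlapsSP[nb1 nb2].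
have nS1 : n.+1%:R = n%:R + 1 :> R by rewrite natr1.
have nS2 : n.+2%:R = n%:R + 1 + 1 :> R by rewrite -nS1 natr1.
have n0 : 0 <= n%:R :> R by [].
have half (u v : R) : `|u - v| <= 2 ^- k -> `|u / 2 - v / 2| <= 2 ^- k.+1.
  by rewrite exprS invfM -mulrBl normrM (ger0_norm (_ : 0 <= 2^-1)) ?invr_ge0 //; lra.
move=> [yl|yu].
  rewrite sols_lower; [|lra|lra].
  rewrite (_ : n.+1%:R + 1 = n.+2%:R); last by rewrite nS2 nS1.
  move=> [u su <-] [v sv <-]; apply: half.
  by apply: IH nb1 su sv => //; lra.
rewrite sols_upper; last by rewrite nS1 -nS2.
rewrite {1 3}nS1 addrK nS1 -nS2; move=> [u su <-] [v sv <-].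
rewrite (_ : (1 + u) / 2 - _ = u / 2 - v / 2); last by field.
have q0 : 0 < 2 ^- n.+1 :> R by rewrite invr_gt0 exprn_gt0.
apply: half; apply: (IH _ _ _ _ _ _ nb2 su sv); last by lra.
(* An upper step never lands on level [0]: [n + 2 < 2 * y <= 2 * (n + 1)] forces [0 < n]. *)
by rewrite -(ltr0n R); lra.
Qed.

(** Existence is the intermediate value theorem between the end values [0] and [n]; uniqueness lets
    [k] grow in [sols_close]. *)
Lemma card_sols_1 n y : (0 < n)%N -> 0 <= y <= n%:R -> ~ overlaps n y ->
  (sols n%:R y #= `I_1)%card.
Proof.
move=> n0 yn nb.
have [||t t01 ty] := @IVT R (tilt n%:R) 0 1 y ler01.
- apply: continuous_subspaceT => x; apply: cvgD; first exact: takagi_continuous.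
  by apply: cvgM; [exact: cvg_cst|exact: cvg_id].
- by rewrite /tilt takagi0 takagi1 mulr0 mulr1 !add0r min_l ?max_r.
rewrite in_itv /= in t01.
suff -> : sols n%:R y = [set t] by exact: card_set1.
apply/seteqP; split => [s sy|_ ->]; last by [].
apply/eqP; rewrite -subr_eq0 -normr_le0; apply/ler_addgt0Pl => e e0; rewrite addr0.
have [k hk] := exists_expN2_lt _ e e0.
by apply: le_trans (ltW hk); apply: sols_close nb _ _.
Qed.
End Measure.

(** * Prescribed cardinalities *)

Section Main.
Context {R : realType}.
Local Notation mu := (@lebesgue_measure R).

(** The window serves the way back to level [0]: [v < n] lets a climb end at [v], and [n / 2 <= v]
    keeps a preceding upper step above its overlap. *)
Definition upper_sols (n c : nat) : set R :=
  [set v | n%:R / 2 <= v < n%:R /\ (sols n%:R v #= `I_c)%card].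

Definition upper_levels (c : nat) : set R :=
  [set y | 1 / 6 < y <= 2 / 3 /\ (level_set y #= `I_c)%card].

(* With [a = n.+3], the point [v = u / 8 + a / 2] at level [a - 1] walks to [u] at
   level [a]: one step down, then two steps up. *)
Lemma charged_upper_sols_pred n c :
  charged (upper_sols n.+3 c) -> charged (upper_sols n.+2 c).
Proof.
apply: (@charged_affine _ 8 (- (4 * n.+3%:R))) => // v.
have n2 : n.+2%:R = n%:R + 2 :> R by rewrite -natrD addn2.
have n3 : n.+3%:R = n%:R + 3 :> R by rewrite -natrD addn3.
have n1 : n.+1%:R = n%:R + 1 :> R by rewrite natr1.
have n0 : 0 <= n%:R :> R by [].
rewrite /upper_sols /= n3 n2 => -[uv hc]; split; first lra.
have p1 : 2 ^- n <= 1 :> R by rewrite invf_le1 ?exprn_gt0 ?exprn_ege1 //; lra.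
have p0 : 0 < 2 ^- n :> R by rewrite invr_gt0 exprn_gt0.
have := @card_sols_upper R n.+2 v; rewrite !exprS !invfM n2 => /(_ _)/card_eql ->; last lra.
have -> : n%:R + 2 - 1 = n.+1%:R :> R by rewrite n1; ring.
have := @card_sols_climb R n.+1 2 (2 * v - (n%:R + 2 + 1)) isT.
rewrite (_ : (n.+1 + 2)%:R = n%:R + 3); last by rewrite addn2.
rewrite expr2 => /(_ _)/card_eql ->; last lra.
by rewrite (_ : 2 * 2 * _ = 8 * v - 4 * (n%:R + 3)) //; ring.
Qed.

(** Levels from [3] on descend one at a time; level [1] climbs to [2] instead. *)
Lemma charged_upper_sols_2 n c :
  (0 < n)%N -> charged (upper_sols n c) -> charged (upper_sols 2 c).
Proof.
case: n => [//|[|n]] _; last first.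
  by elim: n => [//|n IH] /charged_upper_sols_pred.
apply: (@charged_affine _ (1 / 2) 0) => // v [vb hc]; split; first lra.
move: hc; rewrite (card_eql (card_sols_lower _ _ _ _)); [|lra|lra].
by rewrite (_ : 1 + 1 = 2%:R) // (_ : 2 * _ = v) //; field.
Qed.

(** From level [0], [y = v / 4] splits into mirror pieces, each equivalent to [v / 2] at level [1]
    and then to [v] at level [2]; [1 <= v < 2] puts [y] in the required window. *)
Lemma charged_upper_levels_sols n c : (0 < n)%N ->
  charged (upper_sols n c) -> charged (upper_levels (2 * c)).
Proof.
move=> n0 /charged_upper_sols_2 -/(_ n0).
apply: (@charged_affine _ 4 0) => // y [yb hc]; split; first lra.
apply: card_level_double; first by apply/negP => /eqP; lra.
rewrite (card_eql (card_sols_lower _ _ _ _)); [|lra|lra].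
by move: hc; rewrite (_ : 1 + 1 = 2%:R) // (_ : 4 * y + 0 = 2 * (2 * y)) //; ring.
Qed.

(** The overlaps have measure at most [1 / 3], less than the length [1 / 2] of the window. *)
Lemma charged_upper_sols_1 : charged (upper_sols 1 1).
Proof.
exists (`[1 / 2, 1[%classic `\` overlaps 1); split.
- by apply: measurableD => //; exact: measurable_overlaps.
- move=> v [/=]; rewrite in_itv /= => vb nv; split; first lra.
  by apply: card_sols_1 => //; lra.
- apply: lebesgue_measure_setD_gt0 => //; first exact: measurable_overlaps.
  apply: le_lt_trans (measure_overlaps_le 1) _.
  rewrite lebesgue_measure_itv /= lte_fin ifT; last lra.
  by rewrite -EFinB lte_fin expr1; lra.
Qed.

(* Here level [n.+1] with [n = 2 ^ i + 1] plays the role of [a]; the affine change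
   of variable is [w |-> v = (n.+2 + w / 2 ^ n.+2) / 2]. *)
Lemma charged_upper_sols_succ c : charged (upper_levels c) ->
  exists n, (0 < n)%N /\ charged (upper_sols n c.+1).
Proof.
move=> [A [mA AL A0]]; have [i hi] : exists i, ((2 / 3 * 2 ^- i)%:E < mu A)%E.
  case: (mu A) A0 => [r| |//]; last by exists 0%N; rewrite ltry.
  rewrite lte_fin => r0; have [k hk] := exists_expN2_lt _ r r0.
  by exists k; rewrite lte_fin; have : 0 < 2 ^- k :> R; [rewrite invr_gt0 exprn_gt0|lra].
(* Since [2 ^ i < n], the climb of [n.+2 + i] steps from level [n] to level [b], ending at
   [2 ^+ i * w], stays below its levels. *)
pose n := (2 ^ i + 1)%N; pose b := (n + (n.+2 + i))%N; exists n.+1; split => //.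
(* The exceptional [w]; pulling back along the dilation shrinks the bound [2 / 3] to
   [2 / 3 * 2 ^- i], which is why [i] was chosen by the measure of [A]. *)
pose D := (fun w : R => 2 ^+ i * w + 0) @^-1` overlaps b.
have mD : measurable D by apply: measurable_affine; exact: measurable_overlaps.
have i0 : 0 < 2 ^+ i :> R by rewrite exprn_gt0.
have DA : (mu D < mu A)%E.
  apply: le_lt_trans hi; rewrite lebesgue_measure_affine //; last exact: measurable_overlaps.
  rewrite (mulrC (2 / 3)) EFinM; apply: lee_pmul => //.
  apply: le_trans (measure_overlaps_le b) _; rewrite lee_fin.
  have : 0 < 2 ^- b :> R by rewrite invr_gt0 exprn_gt0.
  by lra.
have nE : n%:R = 2 ^+ i + 1 :> R by rewrite natrD natrX.
have n1 : n.+1%:R = n%:R + 1 :> R by rewrite natr1.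
have n2 : n.+2%:R = n%:R + 2 :> R by rewrite -natrD addn2.
have i1 : 1 <= 2 ^+ i :> R by rewrite exprn_ege1 //; lra.
have p0 : 0 < 2 ^+ n.+2 :> R by rewrite exprn_gt0.
have p1 : 1 <= 2 ^+ n.+2 :> R by rewrite exprn_ege1 //; lra.
apply: (@charged_affine _ (2 ^+ n.+2 * 2) (- (2 ^+ n.+2 * n.+2%:R)) (A `\` D)); first 1 last.
- move=> v; set w := _ * _ + _ => -[/AL[wb hc] nD].
  pose z := w / 2 ^+ n.+2.
  have vE : 2 * v = n.+2%:R + z by rewrite /z /w; field; rewrite gt_eqF.
  have z0 : 0 < z by rewrite divr_gt0 //; lra.
  have z1 : z < 1 by rewrite ltr_pdivrMr //; lra.
  have n12 : n.+1%:R + 1 = n.+2%:R :> R by rewrite n1 n2; ring.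
  split; first by rewrite n1; lra.
  rewrite -(addn1 c); apply: card_sols_add; rewrite n12.
  + by apply/negP => /eqP; lra.
  + rewrite vE (card_eql (card_sols_reflect _ _)) (card_eql (card_sols_neg _ _ _)) ?sols0E //.
    by lra.
  + rewrite vE addrAC subrr add0r n1 addrK.
    have zE : 2 ^+ (n.+2 + i) * z = 2 ^+ i * w.
      by rewrite exprD /z; field; rewrite gt_eqF.
    have w0 : 0 <= 2 ^+ i * w by apply: mulr_ge0; [exact: ltW|lra].
    have wi : 2 ^+ i * w <= 2 ^+ i by rewrite ler_piMr ?(ltW i0) //; lra.
    have bE : b%:R = n%:R + n%:R + 2 + i%:R :> R by rewrite /b (natrD _ n) (natrD _ n.+2) n2; ring.
    have ib : 0 <= i%:R :> R by [].
    rewrite (card_eql (card_sols_climb _ (n.+2 + i) _ _ _)) ?zE -/b.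
    * apply: card_sols_1; first by rewrite /b addnS.
        by rewrite bE; lra.
      by rewrite -[_ * w]addr0.
    * by rewrite /n addn1.
    * by rewrite bE; lra.
- exists (A `\` D); split => //; first exact: measurableD.
  exact: lebesgue_measure_setD_gt0.
- by rewrite mulr_gt0.
Qed.

(** Iterates [c |-> 2 * (c + 1)] from [2]. *)
Lemma charged_upper_levels_mersenne m :
  charged (upper_levels (2 * (2 ^ m.+1 - 1))).
Proof.
elim: m => [|m IH].
  exact: (charged_upper_levels_sols 1 1 isT charged_upper_sols_1).
have [n [n0 h]] := charged_upper_sols_succ _ IH.
have := charged_upper_levels_sols _ _ n0 h; congr (charged (upper_levels _)).
rewrite (expnS 2 m.+1); have := expn_gt0 2 m.+1; lia.
Qed.

(** The map [w |-> 1 / 2 + w / 4] fixes [2 / 3] and sends the window into itself, so it can be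
    iterated. *)
Lemma charged_upper_levels_double c :
  charged (upper_levels c) -> charged (upper_levels (2 * c)).
Proof.
apply: (@charged_affine _ 4 (- 2)) => // y [wb hc]; split; first lra.
have -> : y = 1 / 2 + (4 * y + - 2) / 4 by field.
by apply: card_level_hump; [lra|].
Qed.

Lemma charged_upper_levels_pow l m :
  charged (upper_levels (2 ^ l.+1 * (2 ^ m.+1 - 1))).
Proof.
elim: l => [|l IH]; first exact: charged_upper_levels_mersenne.
by rewrite expnS -mulnA; exact: charged_upper_levels_double.
Qed.

(** Factor out [2 ^ l]: the cofactor [2 ^ (k - l) - 1] is odd, so parity rules out [l <= 0]. *)
Lemma even_diff_pow2 (n : nat) (k l : int) : (0 < n)%N ->
  (2 * n)%:R = 2 ^ k - 2 ^ l :> R ->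
  exists i j : nat, (2 * n = 2 ^ i.+1 * (2 ^ j.+1 - 1))%N.
Proof.
move=> n0 h.
have lk : l < k.
  have : 2 ^ l < 2 ^ k :> R by rewrite -subr_gt0 -h ltr0n muln_gt0.
  by rewrite ltr_eXz2l // ltr1n.
have [j kE] : exists j : nat, k = l + j.+1%:Z.
  by exists (`|k - l|.-1)%N; lia.
have h2 : (2 * n)%:R = 2 ^ l * (2 ^+ j.+1 - 1) :> R.
  by rewrite h kE expfzDr ?pnatr_eq0 // mulrBr mulr1.
have p1 : (2 ^ j.+1 - 1)%:R = 2 ^+ j.+1 - 1 :> R.
  by rewrite natrB ?expn_gt0 // natrX.
case: l lk kE h h2 => [[|i]|i] _ _ _ h2.
- move: h2; rewrite expr0z mul1r -p1 => /eqP; rewrite eqr_nat expnS => /eqP.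
  by have := expn_gt0 2 j; lia.
- exists i, j; apply/eqP; rewrite -(eqr_nat R) h2 natrM natrX p1 eqxx //.
(* Here [l = - i.+1]; clearing the denominator equates an even number with an odd one. *)
- have : (2 ^ i.+1 * (2 * n))%:R = (2 ^ j.+1 - 1)%:R :> R.
    by rewrite natrM h2 p1 natrX NegzE -exprnN mulrA mulfV ?mul1r // expf_neq0 ?pnatr_eq0.
  move=> /eqP; rewrite eqr_nat !expnS => /eqP.
  by have := expn_gt0 2 j; lia.
Qed.
End Main.

Theorem theorem5p6 (R : realType) (n : nat) (hn : (0 < n)%N)
  (hkl : exists k l : int, k <> l /\ (2 * n)%:R = 2 ^ k - 2 ^ l :> R) :
  (0 < lebesgue_measure (@level_card_set R (2 * n)%N))%E.
Proof.
have [k [l [_ h]]] := hkl; have [i [j ->]] := even_diff_pow2 _ _ _ hn h.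
apply: charged_outer_gt0; have [A [mA AL A0]] := @charged_upper_levels_pow R i j.
exists A; split => // y /AL[yb hc]; split => //.
by rewrite in_itv /=; lra.
Qed.
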